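(* Let $a_i=i-\tfrac12$ ($i\in\mathbb Z$) and $FS_\mu:=s_{\mu;a}$. For every Young diagram $(p_1,\dots,p_d\mid q_1,\dots,q_d)$ in Frobenius notation, $$FS_{(p_1,\dots,p_d\mid q_1,\dots,q_d)}=\sum_{\substack{p'_1\le p_1,\dots,p'_d\le p_d\\ q'_1\le q_1,\dots,q'_d\le q_d}}\det[c_{p_i,p'_j}]_{i,j=1}^d\,\det[c_{q_i,q'_j}]_{i,j=1}^d\,s_{(p'_1,\dots,p'_d\mid q'_1,\dots,q'_d)},$$ where $c_{pp'}=(-1)^{p-p'}e_{p-p'}(\tfrac12,\tfrac32,\dots,\tfrac{2p-1}2)$ for $p\ge p'$ (with $p$ arguments), $c_{pp'}=0$ for $p'>p$, and the sum is over tuples of nonnegative integers $p'_1>\dots>p'_d\ge0$, $q'_1>\dots>q'_d\ge0$ (so that the indices are Young diagrams in Frobenius notation).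
   Context: $\Lambda$ is the algebra of symmetric functions over $\mathbb C$ with complete homogeneous $h_k$, elementary $e_k$ and Schur functions $s_\mu$. For a sequence $a=(a_i)_{i\in\mathbb Z}$ define $h_{k;a}=\sum_{i=1}^k(-1)^{k-i}e_{k-i}(a_1,\dots,a_{k-1})h_i$ for $k\ge1$, $h_{0;a}=1$, $h_{k;a}=0$ for $k<0$; let $(\tau^ra)_i=a_{i+r}$; and set $s_{\mu;a}=\det[h_{\mu_i-i+j;\,\tau^{1-j}a}]_{i,j=1}^N$ for any $N\ge\ell(\mu)$. Frobenius notation: a diagram $\mu$ with $d$ diagonal boxes is $(p_1,\dots,p_d\mid q_1,\dots,q_d)$ with $p_i=\mu_i-i$, $q_i=\mu'_i-i$, $\mu'$ the transposed diagram. *)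

(* Defs.v *)
From HB Require Import structures.
From mathcomp Require Import all_boot all_order all_algebra all_field.
Set Implicit Arguments. Unset Strict Implicit. Unset Printing Implicit Defensive.
Import Order.TTheory GRing.Theory Num.Theory.
Local Open Scope ring_scope.

Fixpoint esym (s : seq algC) (k : nat) : algC :=
  match s, k with
  | [::], 0%N => 1
  | [::], _.+1 => 0
  | _ :: _, 0%N => 1
  | x :: s', k'.+1 => esym s' k + x * esym s' k'
  end.

(* Λ is modelled as any commutative C-algebra A together with the images
   h k (k >= 1) of the complete homogeneous functions; Λ = C[h_1,h_2,...]
   is free, so identities for all such (A, h) are identities in Λ.
   hk h k = h_k with h_0 = 1 and h_k = 0 for k < 0. *)
Definition hk (A : comAlgType algC) (h : nat -> A) (k : int) : A :=
  match k with
  | Posz 0 => 1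
  | Posz n => h n
  | Negz _ => 0
  end.

Definition hka (A : comAlgType algC) (h : nat -> A) (a : int -> algC) (k : int) : A :=
  match k with
  | Posz 0 => 1
  | Posz n.+1 =>
      \sum_(i < n.+1)
        ((-1) ^+ (n - i) * esym [seq a (Posz j.+1) | j <- iota 0 n] (n - i)) *: h i.+1
  | Negz _ => 0
  end.

Definition tau (r : int) (a : int -> algC) : int -> algC := fun i => a (i + r).

(* s_{mu;a} = det[h_{mu_i - i + j; tau^{1-j} a}]_{i,j=1..N}, with N = size mu
   (0-indexed below). *)
Definition schur_a (A : comAlgType algC) (h : nat -> A) (a : int -> algC)
    (mu : seq nat) : A :=
  \det (\matrix_(i < size mu, j < size mu)
          hka h (tau (- (j%:Z)) a) ((nth 0%N mu i)%:Z - i%:Z + j%:Z)).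

(* ordinary Schur function via Jacobi–Trudi: s_mu = det[h_{mu_i - i + j}] *)
Definition schur (A : comAlgType algC) (h : nat -> A) (mu : seq nat) : A :=
  \det (\matrix_(i < size mu, j < size mu)
          hk h ((nth 0%N mu i)%:Z - i%:Z + j%:Z)).

(* The partition with Frobenius coordinates (p_1..p_d | q_1..q_d)
   (given as two sequences of length d), as the sequence of its parts
   mu_1 >= ... >= mu_{l(mu)} > 0 (l(mu) = q_1 + 1 when d > 0). *)
Definition frob_part (p q : seq nat) : seq nat :=
  let d := size p in
  mkseq (fun i => if (i < d)%N then (nth 0%N p i + i).+1
                  else count (fun j => i <= nth 0%N q j + j)%N (iota 0 d))
        (if q is q0 :: _ then q0.+1 else 0%N).

Definition sdec (s : seq nat) : bool := sorted (fun x y => y < x)%N s.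

Definition a_half (i : int) : algC := i%:~R - 2^-1.

Definition cpp (p p' : nat) : algC :=
  if (p' <= p)%N
  then (-1) ^+ (p - p') * esym [seq a_half (Posz j.+1) | j <- iota 0 p] (p - p')
  else 0.

Definition FS (A : comAlgType algC) (h : nat -> A) (mu : seq nat) : A :=
  schur_a h a_half mu.

(* Main.v *)
Require Import Defs.
From HB Require Import structures.
From mathcomp Require Import all_boot all_order all_algebra all_field.
From mathcomp Require Import perm zify ring.
Import GRing.Theory.
Local Open Scope ring_scope.

(* Index the rows of the Jacobi-Trudi matrix of s_{mu;a} by mu_i - i: the rows of
   (p|q) are the p_i together with the -(r+1) for r not among the q_j. The
   negative rows form a unitriangular block U^a, so writing the other rows as
   X^a = Y^a U^a turns the determinant into det[(-1)^{q_j} Y^a_{p_i,q_j}]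
   (Giambelli's formula). For a_i = i - 1/2 one has h_{k;a} = H(x prod (x - a_m)),
   H being linear with H(x^i) = h_i; splitting the product at the origin gives
   X^a = C X P, and P U^a = U P, where C and P hold the coefficients of
   prod_{m < p} (x - m - 1/2) and prod_{m < j} (x + m + 1/2). Hence
   Y^a = C Y P, and the theorem is the Cauchy-Binet formula applied twice. *)

(** * Strictly decreasing sequences *)

Lemma sdec_nth (s : seq nat) i j :
  sdec s -> (i < j < size s)%N -> (nth 0 s j < nth 0 s i)%N.
Proof.
move=> ss /andP[ij js].
have tr : transitive (fun x y : nat => y < x)%N by move=> x y z /=; lia.
by apply: (sorted_ltn_nth tr 0%N ss); rewrite ?inE //; apply: ltn_trans js.
Qed.

Lemma sdec_ffun_lt {d n : nat} {f : {ffun 'I_d -> 'I_n}} :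
  sdec [seq nat_of_ord (f i) | i <- enum 'I_d] ->
  forall i j : 'I_d, (i < j)%N -> (f j < f i)%N.
Proof.
move=> sf i j ij; have := @sdec_nth _ i j sf.
have nthE (k : 'I_d) : nth 0%N [seq nat_of_ord (f i) | i <- enum 'I_d] k = f k.
  by rewrite (nth_map k 0%N) ?nth_ord_enum ?size_enum_ord.
by rewrite size_map size_enum_ord ij ltn_ord !nthE; apply.
Qed.

(** * The Cauchy-Binet formula *)

Section CauchyBinet.
Variables (d n : nat).
Implicit Types f g : {ffun 'I_d -> 'I_n}.

Let geo (x y : 'I_n) := (y <= x)%N.
(** The values of [f] in decreasing order. Since ['I_n] may be empty, [f i] itself supplies the
    default of [nth]. *)
Let sort_ffun f : {ffun 'I_d -> 'I_n} :=
  [ffun i : 'I_d => nth (f i) (sort geo [seq f j | j <- enum 'I_d]) i].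

Let map_sort_ffun f :
  [seq sort_ffun f i | i <- enum 'I_d] = sort geo [seq f j | j <- enum 'I_d].
Proof.
have sizeE : size (sort geo [seq f j | j <- enum 'I_d]) = d.
  by rewrite size_sort size_map size_enum_ord.
case: (posnP d) => [d0|d0].
  by rewrite [RHS]size0nil ?sizeE // [LHS]size0nil // size_map size_enum_ord.
apply: (@eq_from_nth _ (f (Ordinal d0))); rewrite ?sizeE size_map ?size_enum_ord //.
move=> i id; rewrite (nth_map (Ordinal d0)) ?size_enum_ord // ffunE nth_enum_ord //.
by apply: set_nth_default; rewrite sizeE.
Qed.

Let geo_total : total geo. Proof. by move=> x y; rewrite /geo; lia. Qed.
Let geo_trans : transitive geo. Proof. by move=> x y z; rewrite /geo; lia. Qed.
Let geo_anti : antisymmetric geo.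
Proof. by move=> x y; rewrite /geo => ?; apply: val_inj => /=; lia. Qed.

Let sdec_sort f :
  injectiveb f -> sdec [seq nat_of_ord (sort_ffun f i) | i <- enum 'I_d].
Proof.
move/injectiveP=> finj; rewrite (map_comp (@nat_of_ord n)) map_sort_ffun.
rewrite /sdec sorted_map.
have us : uniq (sort geo [seq f j | j <- enum 'I_d]).
  by rewrite sort_uniq map_inj_uniq ?enum_uniq.
have := sort_sorted geo_total [seq f j | j <- enum 'I_d].
move: us; case: (sort _ _) => //= x s.
elim: s x => //= y s IHs x /andP[]; rewrite inE negb_or => /andP[xy _].
move=> us /andP[gxy ps]; rewrite IHs // andbT.
by move: xy gxy; rewrite -val_eqE /geo /= /relpre /=; lia.
Qed.

Let sdec_sorted g :
  sdec [seq nat_of_ord (g i) | i <- enum 'I_d] ->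
  sorted geo [seq g i | i <- enum 'I_d].
Proof.
rewrite (map_comp (@nat_of_ord n)) /sdec sorted_map.
by apply: sub_sorted => x y /=; rewrite /relpre /geo /=; apply: ltnW.
Qed.

Let perm_codom g (s : 'S_d) :
  perm_eq [seq g (s i) | i <- enum 'I_d] [seq g i | i <- enum 'I_d].
Proof.
rewrite (map_comp g s); apply: perm_map.
apply: uniq_perm; rewrite ?enum_uniq //.
  by rewrite map_inj_uniq ?enum_uniq //; apply: perm_inj.
move=> i; rewrite mem_enum; apply/mapP; exists ((s^-1)%g i); rewrite ?mem_enum //.
by rewrite permKV.
Qed.

Let sort_comp g (s : 'S_d) :
  sdec [seq nat_of_ord (g i) | i <- enum 'I_d] ->
  sort_ffun [ffun i => g (s i)] = g.
Proof.
move=> sg; apply/ffunP => i.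
suff : [seq sort_ffun [ffun i => g (s i)] i | i <- enum 'I_d]
       = [seq g i | i <- enum 'I_d].
  by move/eq_in_map/(_ i); apply; rewrite mem_enum.
rewrite map_sort_ffun; apply: (sorted_eq geo_trans geo_anti).
- exact: sort_sorted.
- exact: sdec_sorted.
rewrite perm_sort; under eq_map => j do rewrite ffunE.
exact: perm_codom.
Qed.

Let sort_orbit f : exists s : 'S_d, f = [ffun i => sort_ffun f (s i)].
Proof.
have : perm_eq [tuple f i | i < d] [tuple sort_ffun f i | i < d].
  by rewrite /= map_sort_ffun perm_sym perm_sort.
case/tuple_permP => s es; exists s; apply/ffunP => i.
have /eq_in_map/(_ i) : [seq f i | i <- enum 'I_d]
   = [seq tnth [tuple sort_ffun f i | i < d] (s i) | i <- enum 'I_d] by exact: es.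
by rewrite mem_enum => ->; rewrite ?ffunE // tnth_mktuple ffunE.
Qed.

(** An injective map is a strictly decreasing one precomposed with a permutation, and both are
    unique; the decreasing map is found by sorting the values. *)
Lemma sum_injective_ffun (V : nmodType) (F : {ffun 'I_d -> 'I_n} -> V) :
  \sum_(f : {ffun 'I_d -> 'I_n} | injectiveb f) F f =
  \sum_(g : {ffun 'I_d -> 'I_n} | sdec [seq nat_of_ord (g i) | i <- enum 'I_d])
    \sum_(s : 'S_d) F [ffun i => g (s i)].
Proof.
rewrite (partition_big sort_ffun
  (fun g : {ffun 'I_d -> 'I_n} => sdec [seq nat_of_ord (g i) | i <- enum 'I_d])) => [|f]; last exact: sdec_sort.
apply: eq_bigr => g sg.
have ginj : injective g.
  move=> i j gij; apply: val_inj => /=.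
  case: (ltngtP i j) => // [ij|ij]; have := sdec_ffun_lt sg _ _ ij;
  by rewrite gij ltnn.
have hinj : injective (fun s : 'S_d => [ffun i => g (s i)] : {ffun 'I_d -> 'I_n}).
  move=> s t /ffunP st; apply/permP => i; apply: ginj.
  by have := st i; rewrite !ffunE.
transitivity (\sum_(f in [set ([ffun i => g (s i)] : {ffun 'I_d -> 'I_n}) | s : 'S_d]) F f).
  2: by rewrite big_imset //= => s t _ _; apply: hinj.
apply: eq_bigl => f; symmetry.
apply/imsetP/andP => [[s _ ->]|[_ /eqP <-]].
  split; last by rewrite sort_comp.
  by apply/injectiveP => i j; rewrite !ffunE => /ginj; apply: perm_inj.
by have [s fs] := sort_orbit f; exists s.
Qed.

(** Multilinearity in the rows expands the left side over all maps f. A non-injective f repeats a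
    row of [B]; the injective ones are grouped by their sorted form g, and the signs of the
    permutations assemble the minor of [A]. *)
Lemma cauchy_binet (R : comNzRingType) (A : 'M[R]_(d, n)) (B : 'M[R]_(n, d)) :
  \det (A *m B) =
  \sum_(g : {ffun 'I_d -> 'I_n} | sdec [seq nat_of_ord (g i) | i <- enum 'I_d])
    \det (colsub g A) * \det (rowsub g B).
Proof.
pose F (f : {ffun 'I_d -> 'I_n}) := (\prod_i A i (f i)) * \det (rowsub f B).
transitivity (\sum_(f : {ffun 'I_d -> 'I_n}) F f).
  rewrite /determinant; under eq_bigr => s _.
    under eq_bigr => i _ do rewrite mxE.
    rewrite bigA_distr_bigA mulr_sumr; over.
  rewrite exchange_big; apply: eq_bigr => f _; rewrite /F mulr_sumr.
  apply: eq_bigr => s _; rewrite big_split /= mulrCA; congr (_ * (_ * _)).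
  by apply: eq_bigr => i _; rewrite mxE.
rewrite (bigID (fun f : {ffun 'I_d -> 'I_n} => injectiveb f)) /=.
rewrite [X in _ + X]big1 => [|f /injectivePn[i [j ij fij]]]; last first.
  rewrite /F (determinant_alternate ij) ?mulr0 // => k.
  by rewrite !mxE fij.
rewrite addr0 sum_injective_ffun; apply: eq_bigr => g _.
rewrite mulr_suml; apply: eq_bigr => s _; rewrite /F.
have -> : rowsub [ffun i => g (s i)] B = row_perm s (rowsub g B).
  by apply/matrixP => i j; rewrite !mxE ffunE.
rewrite row_permE det_mulmx det_perm mulrCA mulrA; congr (_ * _ * _).
by apply: eq_bigr => i _; rewrite ffunE mxE.
Qed.

End CauchyBinet.

(** * Determinants in Frobenius coordinates: a vanishing criterion and Giambelli's formula *)

(** For rows k >= i0 and columns l <= i0 one has p k <= p i0 < p' i0 <= p' l, so these entries form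
    a zero block with d - i0 rows and i0 + 1 columns, which every permutation meets. *)
Lemma det_decreasing_eq0 (R : comNzRingType) (d : nat) (p p' : nat -> nat)
    (c : nat -> nat -> R) (i0 : 'I_d) :
  (forall i j, (i <= j < d)%N -> (p j <= p i)%N) ->
  (forall i j, (i <= j < d)%N -> (p' j <= p' i)%N) ->
  (forall k l, (k < l)%N -> c k l = 0) -> (p i0 < p' i0)%N ->
  \det (\matrix_(i < d, j < d) c (p i) (p' j)) = 0.
Proof.
move=> pdec p'dec c0 lt0; rewrite /determinant big1 // => s _.
(* pigeonhole: s cannot map the rows k >= i0 into the columns > i0 *)
have [k ik sk] : exists2 k : 'I_d, (i0 <= k)%N & (s k <= i0)%N.
  apply/exists_inP; rewrite -[X in is_true X]negbK negb_exists_in.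
  apply/negP => /forall_inP sgt.
  have : (#|s @: [set k : 'I_d | (i0 <= k)%N]|
      <= #|[set k : 'I_d | (i0 <= k)%N] :\ i0|)%N.
    apply/subset_leq_card/subsetP => _ /imsetP[k + ->].
    rewrite !inE => /sgt; rewrite -ltnNge => ik.
    by rewrite (ltnW ik) andbT -val_eqE /= neq_ltn ik orbT.
  rewrite (card_imset _ (@perm_inj _ s)) (cardsD1 i0 [set k : 'I_d | _]).
  by rewrite inE leqnn; lia.
rewrite (bigD1 k) //= mxE c0 ?mul0r ?mulr0 //.
have := pdec i0 k; have := p'dec (s k) i0.
by have := ltn_ord k; have := ltn_ord i0; lia.
Qed.

(* For i >= size q, the (i - size q)-th natural number not occurring in q: below
   its diagonal boxes, frob_part p q has mu_i - i = - frob_row q i (i from 0). *)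
Definition frob_row (q : seq nat) (i : nat) : nat :=
  i - count (fun j => i <= nth 0 q j + j)%N (iota 0 (size q)).

Lemma sdec_cons x s : sdec (x :: s) -> all (fun y => y < x)%N s && sdec s.
Proof.
move=> xs; apply/andP; split; last exact: path_sorted xs.
by apply: order_path_min xs => y z t /=; lia.
Qed.

(** The i entries before position i are distinct and lie strictly between entry i and n. *)
Lemma sdec_addn_le (s : seq nat) i n :
  sdec s -> all (fun x => x < n)%N s -> (i < size s)%N -> (nth 0 s i + i < n)%N.
Proof.
elim: s i n => // x s IHs [|i] n /sdec_cons/andP[sx ss] /= /andP[xn _] id.
  by rewrite addn0.
by have := IHs i x ss sx id; lia.
Qed.

Lemma sdec_size_le (s : seq nat) n : sdec s -> all (fun x => x < n)%N s -> (size s <= n)%N.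
Proof.
move=> ss sn; case: (posnP (size s)) => [->//|s0].
by have := @sdec_addn_le s (size s).-1 n ss sn; lia.
Qed.

Lemma frob_row_top (q : seq nat) n :
  sdec q -> all (fun x => x < n)%N q -> frob_row q n = n.
Proof.
move=> qs qn; rewrite /frob_row -[RHS]subn0; congr (_ - _)%N; apply/eqP.
rewrite -leqn0 leqNgt -has_count; apply/hasPn => j; rewrite mem_iota /= => jd.
by have := @sdec_addn_le q j n qs qn; lia.
Qed.

(** Prepending n adds one occupied value above the free ones, which only shifts their positions by
    one. *)
Lemma frob_row_cons (q : seq nat) n i :
  (i < n)%N -> frob_row (n :: q) i.+1 = frob_row q i.
Proof.
move=> lt_in; rewrite /frob_row /= addn0 lt_in add1n subSS; congr (_ - _)%N.
rewrite -(addn0 1%N) iotaDl count_map; apply: eq_count => j /=.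
by rewrite addnCA add1n ltnS.
Qed.

(** The rows from [size q] on are unit vectors supported on the columns outside q; removing them
    leaves the columns q_j, up to sign. The induction removes the last column. *)
Lemma det_frob_rows (R : comNzRingType) (N : nat) (q : seq nat)
    (Y : nat -> nat -> R) :
  sdec q -> all (fun x => x < N)%N q ->
  \det (\matrix_(i < N, j < N)
    if (i < size q)%N then Y i j else (j == frob_row q i :> nat)%:R) =
  (-1) ^+ sumn q * \det (\matrix_(i < size q, j < size q) Y i (nth 0 q j)).
Proof.
elim: N q Y => [|N IHN] q Y qs qN.
  by case: q qs qN => // _ _; rewrite !det_mx00 mulr1.
(* If column N does not occur in q, the last row is the unit vector of that column. *)
case: (boolP (all (fun x => x < N)%N q)) => [qN'|].
  rewrite -IHN // (expand_det_row _ ord_max) (bigD1 ord_max) //=.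
  have dN := sdec_size_le _ _ qs qN'.
  rewrite big1 => [|j jN]; last first.
    rewrite !mxE /= ltnNge dN /= frob_row_top //.
    suff -> : (nat_of_ord j == N) = false by rewrite mul0r.
    by apply/negbTE; move: jN; rewrite -val_eqE.
  rewrite !mxE /= ltnNge dN /= frob_row_top // eqxx mul1r addr0 /cofactor.
  rewrite addnn -signr_odd odd_double mul1r.
  congr (\det _); apply/matrixP => i j.
  by rewrite !mxE !lift_max.
case: q qs qN => // x q qs /= /andP[xN qN] nqN.
have /andP[qx {}qs] := sdec_cons _ _ qs.
have {nqN} ex : x = N.
  apply/eqP; rewrite eqn_leq -ltnS xN leqNgt; apply: contra nqN => {}xN.
  by rewrite xN; apply: sub_all qx => y /=; lia.
subst x; have dN := sdec_size_le _ _ qs qx.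
rewrite (expand_det_col _ ord_max).
rewrite (bigID (fun i : 'I_N.+1 => (i < (size q).+1)%N)) /= [X in _ + X]big1.
  2: {
  move=> i; rewrite -leqNgt => di; rewrite !mxE /= ltnNge di /=.
  suff -> : (N == frob_row (N :: q) i) = false by rewrite mul0r.
  case: i di => [[|i] iN] //= _; rewrite frob_row_cons //.
  by apply/eqP; rewrite /frob_row; lia. }
have dN1 : ((size q).+1 <= N.+1)%N by [].
rewrite addr0 (big_ord_narrow dN1) /=.
(* Now N heads q, so the last column on the left is the first one on the right. The cofactor signs
   differ by (-1)^N, the contribution of N to [sumn]. *)
rewrite (expand_det_col _ ord0) mulr_sumr; apply: eq_bigr => i _.
rewrite !mxE /= ltn_ord [RHS]mulrCA; congr (_ * _).
rewrite /cofactor /= addn0 exprD -!mulrA.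
rewrite [RHS]mulrCA exprD -mulrA; congr (_ * (_ * _)).
pose Y' i' j := Y (bump i i') j.
transitivity (\det (\matrix_(i' < N, j < N)
    if (i' < size q)%N then Y' i' j else (j == frob_row q i' :> nat)%:R)).
  congr (\det _); apply/matrixP => i' j; rewrite !mxE /=.
  have -> : bump N j = j by rewrite /bump leqNgt ltn_ord.
  have -> : (bump i i' < (size q).+1)%N = (i' < size q)%N.
    by rewrite /bump; have := ltn_ord i; case: leqP; lia.
  case: ltnP => // di'; rewrite /bump.
  have -> : (i <= i')%N by have := ltn_ord i; lia.
  by rewrite frob_row_cons.
rewrite IHN //; congr (_ * \det _); apply/matrixP => i' j.
by rewrite !mxE /Y' lift0.
Qed.

(** [E k j] is the entry of degree k in column j; its dependence on j allows for the shifts of a.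
    The matrix factors as M U, with U unitriangular and M made of the rows Y(p_i, -) followed by
    unit vectors, so that [det_frob_rows] evaluates det M. *)
Lemma giambelli (R : comNzRingType) (E : int -> nat -> R) (Y : nat -> nat -> R)
    (d : nat) (p q : seq nat) :
  size p = d -> size q = d -> sdec q ->
  (forall j, E 0 j = 1) -> (forall n j, E (Negz n) j = 0) ->
  (forall k j, E (Posz (k + j).+1) j
     = \sum_(l < j.+1) Y k l * E (j%:Z - l%:Z) j) ->
  \det (\matrix_(i < size (frob_part p q), j < size (frob_part p q))
     E ((nth 0%N (frob_part p q) i)%:Z - i%:Z + j%:Z) j) =
  (-1) ^+ sumn q * \det (\matrix_(i < d, j < d) Y (nth 0%N p i) (nth 0%N q j)).
Proof.
move=> pd qd qs E0 Eneg EY.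
set N := size _.
have NE : N = if q is q0 :: _ then q0.+1 else 0%N by rewrite /N size_mkseq.
have qN : all (fun x => x < N)%N q.
  rewrite NE; case: (q) qs => //= q0 q' /sdec_cons/andP[q0q' _].
  by rewrite leqnn; apply: sub_all q0q' => x /=; lia.
have := @det_frob_rows R N q (fun i j => Y (nth 0%N p i) j) qs qN.
rewrite qd => <-.
pose U : 'M[R]_N := \matrix_(l, j) E (j%:Z - l%:Z) j.
have detU : \det U = 1.
  rewrite -det_tr det_trig; last first.
    apply/is_trig_mxP => i j ij; rewrite !mxE.
    have -> : i%:Z - j%:Z = Negz (j - i).-1 by lia.
    exact: Eneg.
  by rewrite big1 // => i _; rewrite !mxE subrr E0.
rewrite -[RHS]mulr1 -[X in _ = _ * X]detU -det_mulmx; congr (\det _).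
apply/matrixP => i j; rewrite !mxE.
have nthE : nth 0%N (frob_part p q) i = if (i < d)%N then (nth 0%N p i + i).+1
    else count (fun j => i <= nth 0%N q j + j)%N (iota 0 d).
  by rewrite nth_mkseq ?pd // -NE.
rewrite nthE; under eq_bigr => l _ do rewrite !mxE.
case: ltnP => id.
  (* With rows counted from 0, mu_i - i equals p_i + 1 on the diagonal rows. *)
  have -> : (nth 0%N p i + i).+1%:Z - i%:Z + j%:Z = Posz (nth 0%N p i + j).+1 by lia.
  rewrite EY (big_ord_widen N (fun l => Y (nth 0%N p i) l * E (j%:Z - l%:Z) j)) //.
  rewrite big_mkcond; apply: eq_bigr => l _; case: ltnP => // jl.
  have -> : j%:Z - l%:Z = Negz (l - j).-1 by lia.
  by rewrite Eneg mulr0.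
have rN : (frob_row q i < N)%N by rewrite /frob_row; have := ltn_ord i; lia.
rewrite (bigD1 (Ordinal rN)) //= eqxx mul1r big1 ?addr0 => [|l lr]; last first.
  suff -> : (nat_of_ord l == frob_row q i) = false by rewrite mul0r.
  by apply/negbTE; move: lr; rewrite -val_eqE.
congr (E _ _); rewrite /frob_row qd.
have := count_size (fun j => i <= nth 0%N q j + j)%N (iota 0 d).
by rewrite size_iota; lia.
Qed.

(** * Unitriangular linear systems *)

(** Forward substitution; a list carries the earlier unknowns that each new one depends on. *)
Fixpoint triangular_solution (R : nzRingType) (x : nat -> R)
    (U : nat -> nat -> R) (n : nat) : seq R :=
  if n is m.+1 then
    let s := triangular_solution R x U m in
    rcons s (x m - \sum_(l < m) s`_l * U l m)
  else [::].

Lemma triangular_solutionP (R : nzRingType) (x : nat -> R) (U : nat -> nat -> R) :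
  (forall j, U j j = 1) ->
  forall j, x j = \sum_(l < j.+1) (triangular_solution R x U l.+1)`_l * U l j.
Proof.
move=> U1 j; have sizeE n : size (triangular_solution R x U n) = n.
  by elim: n => //= n IHn; rewrite size_rcons IHn.
(* Each stage only appends, so entry l is final from stage l + 1 on. *)
have stable n l : (l < n)%N ->
    (triangular_solution R x U n)`_l = (triangular_solution R x U l.+1)`_l.
  elim: n => // n IHn; rewrite ltnS leq_eqVlt => /predU1P[->//|ln].
  by rewrite [LHS]/= nth_rcons sizeE ln IHn.
rewrite big_ord_recr /= nth_rcons sizeE ltnn eqxx U1 mulr1.
rewrite [X in X + _](eq_bigr (fun l : 'I_j => (triangular_solution R x U j)`_l * U l j)).
  by rewrite addrC subrK.
by move=> l _; rewrite [in RHS]stable.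
Qed.

(** * The functional H and the polynomials behind h_{k;a} *)

Section LinearFunctional.
Variables (A : comAlgType algC) (u : nat -> A).

Definition hlin (P : {poly algC}) : A := \sum_(i < size P) P`_i *: u i.

Lemma hlin_widen n (P : {poly algC}) :
  (size P <= n)%N -> hlin P = \sum_(i < n) P`_i *: u i.
Proof.
move=> Pn; rewrite /hlin (big_ord_widen n (fun i => P`_i *: u i)) // big_mkcond.
by apply: eq_bigr => i _; case: ltnP => // Pi; rewrite nth_default // scale0r.
Qed.

Fact hlin_is_linear : linear hlin.
Proof.
move=> c P Q; pose n := maxn (size P) (size Q).
have PQn : (size (c *: P + Q)%R <= n)%N.
  apply: leq_trans (size_polyD _ _) _.
  by have := size_scale_leq c P; rewrite /n; lia.
rewrite !(hlin_widen n) ?leq_maxl ?leq_maxr // scaler_sumr -big_split /=.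
by apply: eq_bigr => i _; rewrite coefD coefZ scalerDl scalerA.
Qed.

HB.instance Definition _ :=
  GRing.isLinear.Build algC {poly algC} A *:%R hlin hlin_is_linear.

Lemma hlinXn n : hlin 'X^n = u n.
Proof.
rewrite (hlin_widen n.+1) ?size_polyXn // big_ord_recr /= coefXn eqxx scale1r.
by rewrite big1 ?add0r // => i _; rewrite coefXn ltn_eqF ?scale0r.
Qed.

Lemma hlinM n m (P Q : {poly algC}) :
  (size P <= n)%N -> (size Q <= m)%N ->
  hlin (P * Q) = \sum_(i < n) \sum_(j < m) (P`_i * Q`_j) *: u (i + j)%N.
Proof.
move=> Pn Qm; have polyE k (S : {poly algC}) : (size S <= k)%N ->
    S = \sum_(i < k) S`_i *: 'X^i.
  move=> Sk; rewrite -[LHS]coefK poly_def.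
  rewrite (big_ord_widen k (fun i => S`_i *: 'X^i)) // big_mkcond.
  by apply: eq_bigr => i _; case: ltnP => // ?; rewrite nth_default // scale0r.
rewrite {1}(polyE n P) // {1}(polyE m Q) // mulr_suml linear_sum.
apply: eq_bigr => i _; rewrite mulr_sumr linear_sum; apply: eq_bigr => j _.
by rewrite -scalerAl -scalerAr scalerA -exprD linearZ /= hlinXn.
Qed.

End LinearFunctional.

Lemma hlinXM (A : comAlgType algC) (u : nat -> A) (P : {poly algC}) :
  hlin A u ('X * P) = hlin A (fun i => u i.+1) P.
Proof.
rewrite (hlin_widen A u (size P).+1) ?(leq_trans (size_polyMleq _ _)) ?size_polyX //.
rewrite big_ord_recl coefXM scale0r add0r.
by apply: eq_bigr => i _; rewrite coefXM.
Qed.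

Lemma esym_gt_size (s : seq algC) k : (size s < k)%N -> Defs.esym s k = 0.
Proof.
by elim: s k => [|x s IHs] [|k] //= sk; rewrite !IHs ?mulr0 ?addr0 // ltnW.
Qed.

Lemma esym0 (s : seq algC) : Defs.esym s 0 = 1.
Proof. by case: s. Qed.

(** Vieta's formulas, by the recursion that defines [esym]. *)
Lemma coef_prod_XsubC_esym (s : seq algC) k :
  (\prod_(x <- s) ('X - x%:P))`_k =
  if (k <= size s)%N then (-1) ^+ (size s - k) * Defs.esym s (size s - k) else 0.
Proof.
elim: s k => [|x s IHs] k.
  by rewrite big_nil coef1; case: k => [|k] //=; rewrite mul1r.
rewrite big_cons mulrBl coefB coefXM coefCM !IHs /=; case: k => [|k] /=.
  by rewrite !subn0 sub0r exprS (esym_gt_size s (size s).+1) // add0r; ring.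
rewrite ltnS subSS; case: (ltngtP k (size s)) => [ks|ks|->].
- have -> : (size s - k = (size s - k.+1).+1)%N by lia.
  by rewrite /= exprS; ring.
- by rewrite mulr0 subr0.
- by rewrite subnn esym0 mulr0 subr0.
Qed.

(** The coefficients in the definition of h_{k;a} are those of Vieta; the factor X reflects that its
    sum starts at i = 1. *)
Lemma hkaE (A : comAlgType algC) (h : nat -> A) (a : int -> algC) n :
  hka h a (Posz n.+1) =
  hlin A (fun i => hk h i) ('X * \prod_(i < n) ('X - (a (Posz i.+1))%:P)).
Proof.
have -> : \prod_(i < n) ('X - (a (Posz i.+1))%:P) =
    \prod_(x <- [seq a (Posz i.+1) | i <- iota 0 n]) ('X - x%:P).
  by rewrite big_map -[n in iota _ n]subn0 big_mkord.
rewrite hlinXM (hlin_widen A _ n.+1); last first.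
  by rewrite size_prod_XsubC size_map size_iota.
apply: eq_bigr => i _; congr (_ *: _).
by rewrite coef_prod_XsubC_esym size_map size_iota -ltnS ltn_ord.
Qed.

(** * Products of half-integer linear factors *)

Definition half_int (m : nat) : algC := m%:R + 2^-1.

(** The factors are x - a_{-m}, since a_{-m} = -(m + 1/2). *)
Definition up_prod (l j : nat) : {poly algC} :=
  \prod_(l <= m < j) ('X + (half_int m)%:P).

Lemma a_half_pos m : a_half (Posz m.+1) = half_int m.
Proof.
rewrite /a_half /half_int -addn1 PoszD rmorphD /=.
by field.
Qed.

(** This symmetry of the half-integers is why the same coefficients c serve the p_i and the q_i. *)
Lemma a_half_opp (z : int) : a_half (1 - z) = - a_half z.
Proof.
by rewrite /a_half rmorphB /=; field.
Qed.

Lemma cppE p p' : cpp p p' = (\prod_(m < p) ('X - (half_int m)%:P))`_p'.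
Proof.
have -> : \prod_(m < p) ('X - (half_int m)%:P) =
    \prod_(x <- [seq a_half (Posz m.+1) | m <- iota 0 p]) ('X - x%:P).
  rewrite big_map -[p in iota _ p]subn0 big_mkord.
  by apply: eq_bigr => i _; rewrite a_half_pos.
by rewrite coef_prod_XsubC_esym size_map size_iota.
Qed.

Lemma cpp_gt p p' : (p < p')%N -> cpp p p' = 0.
Proof. by rewrite /cpp ltnNge => /negbTE->. Qed.

Lemma up_prodS l j : (l <= j)%N ->
  up_prod l j.+1 = up_prod l j * ('X + (half_int j)%:P).
Proof. by move=> lj; rewrite /up_prod big_nat_recr. Qed.

(** The substitution of -x for x exchanges the two products up to the sign (-1)^j. *)
Lemma coef_up_prod j l : (up_prod 0 j)`_l = (-1) ^+ (j + l) * cpp j l.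
Proof.
rewrite cppE; elim: j l => [|j IHj] l.
  by rewrite /up_prod big_geq // big_ord0 coef1; case: l => [|l]; rewrite ?mulr0 ?mulr1.
rewrite up_prodS // big_ord_recr /= mulrDr mulrBr coefD coefB !coefMX !coefMC !IHj.
by case: l => [|l] /=; rewrite ?addn0 ?addSn ?addnS !exprS; ring.
Qed.

Lemma size_up_prod j : (size (up_prod 0 j) <= j.+1)%N.
Proof.
by apply/leq_sizeP => l jl; rewrite coef_up_prod cpp_gt ?mulr0.
Qed.

(** The arguments a_{i+1-j} with i < j have nonpositive index and equal -(m + 1/2) for m = j - i -
    1. *)
Lemma prod_tau_a_half n j : (n <= j)%N ->
  \prod_(i < n) ('X - (tau (- j%:Z) a_half (Posz i.+1))%:P) = up_prod (j - n) j.
Proof.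
elim: n => [|n IHn] nj; first by rewrite big_ord0 subn0 /up_prod big_geq.
rewrite big_ord_recr /= IHn 1?ltnW // /up_prod.
rewrite [RHS]big_ltn; last by lia.
have -> : (j - n = (j - n.+1).+1)%N by lia.
rewrite mulrC; congr (('X + _) * _); rewrite -polyCN; congr (_%:P).
rewrite /tau -a_half_pos -a_half_opp; congr (a_half _); lia.
Qed.

(* Under x^i |-> h_i this becomes the entry in row -(i+1) and column j (from 0)
   of the Jacobi-Trudi matrix of s_{mu;a}, for i <= j. *)
Definition neg_row_poly (i j : nat) : {poly algC} :=
  if i == j then 1 else 'X * up_prod i.+1 j.

Lemma neg_row_poly_diag i : neg_row_poly i i = 1.
Proof. by rewrite /neg_row_poly eqxx. Qed.

Lemma neg_row_poly_lt i j : (i < j)%N -> neg_row_poly i j = 'X * up_prod i.+1 j.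
Proof. by move=> ij; rewrite /neg_row_poly ltn_eqF. Qed.

Lemma up_prod_geq i j : (j <= i)%N -> up_prod i j = 1.
Proof. by move=> ji; rewrite /up_prod big_geq. Qed.

(* Under x^i |-> h_i this reads U P = P U^a, where U and U^a are the negative-row
   blocks of the two Jacobi-Trudi matrices and P the matrix of coefficients of
   the polynomials prod_{m < j} (x + m + 1/2). *)
Lemma drop_up_prod l j :
  drop_poly l (up_prod 0 j) =
  \sum_(i < j.+1) (up_prod 0 i)`_l *: neg_row_poly i j.
Proof.
elim: j => [|j IHj].
  rewrite big_ord_recl big_ord0 addr0 neg_row_poly_diag up_prod_geq //.
  apply/polyP => i; rewrite coef_drop_poly coefZ !coef1.
  by case: i l => [|i] [|l]; rewrite ?mulr1 ?mulr0.
rewrite 2!big_ord_recr /= neg_row_poly_diag neg_row_poly_lt // (up_prod_geq j.+1) //.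
(* From j to j + 1 the terms with i < j gain the factor x + j + 1/2, whereas the diagonal term 1
   becomes x; what remains is compared coefficientwise. *)
rewrite (eq_bigr (fun i : 'I_j => ((up_prod 0 i)`_l *: neg_row_poly i j)
   * ('X + (half_int j)%:P))); last first.
  move=> i _; have ij1 : (i < j.+1)%N by apply: ltnW; rewrite ltnS.
  by rewrite !neg_row_poly_lt // up_prodS // -scalerAl mulrA.
rewrite -mulr_suml.
have -> : \sum_(i < j) (up_prod 0 i)`_l *: neg_row_poly i j
     = drop_poly l (up_prod 0 j) - ((up_prod 0 j)`_l)%:P.
  by rewrite IHj big_ord_recr /= neg_row_poly_diag alg_polyC addrK.
rewrite mulr1 alg_polyC up_prodS //; apply/polyP => k.
rewrite !(coefD, coefMX, coefMC, mulrDr, mulrBl, coefN, coefC, coef_drop_poly, coefZ, coefX).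
case: k => [|[|k]] /=; rewrite ?add0n ?add1n ?addSn /=; try by ring.
by case: l {IHj} => [|l] /=; ring.
Qed.

(** * Rows of the two Jacobi-Trudi matrices and their coordinates Y and Y^a *)

Lemma hka_neg_row (A : comAlgType algC) (h : nat -> A) l j : (l <= j)%N ->
  hka h (tau (- j%:Z) a_half) (j%:Z - l%:Z) =
  hlin A (fun i => hk h i) (neg_row_poly l j).
Proof.
rewrite leq_eqVlt => /predU1P[->|lj].
  by rewrite subrr neg_row_poly_diag -(expr0 'X) hlinXn.
have -> : j%:Z - l%:Z = Posz (j - l.+1).+1 by lia.
rewrite hkaE prod_tau_a_half; last by lia.
by rewrite neg_row_poly_lt // subKn.
Qed.

(** This is X^a = C X P: the first j arguments a_{1-j}, ..., a_0 give a column of P, the other k,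
    a_1, ..., a_k, give a row of C. *)
Lemma hka_pos_row (A : comAlgType algC) (h : nat -> A) k j :
  hka h (tau (- j%:Z) a_half) (Posz (k + j).+1) =
  \sum_(k' < k.+1) \sum_(j' < j.+1)
     (cpp k k' * (up_prod 0 j)`_j') *: hk h (Posz (k' + j').+1).
Proof.
rewrite hkaE addnC big_split_ord /= -[\prod_(i < j) _]/(\prod_(i < j)
  ('X - (tau (- j%:Z) a_half (Posz i.+1))%:P)) prod_tau_a_half // subnn.
have -> : \prod_(i < k) ('X - (tau (- j%:Z) a_half (Posz (j + i).+1))%:P)
    = \prod_(m < k) ('X - (half_int m)%:P).
  apply: eq_bigr => i _; rewrite -a_half_pos /tau; congr ('X - (a_half _)%:P).
  by lia.
rewrite [_ * (\prod_(m < k) _)]mulrC hlinXM (hlinM A _ k.+1 j.+1).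
- by apply: eq_bigr => k' _; apply: eq_bigr => j' _; rewrite cppE.
- by apply/leq_sizeP => l kl; rewrite -cppE cpp_gt.
- exact: size_up_prod.
Qed.

(* Up to the sign (-1)^l this is the hook Schur function s_{(k|l)}. *)
Definition frob_coord (A : comAlgType algC) (h : nat -> A) (k l : nat) : A :=
  (triangular_solution A (fun j => hk h (Posz (k + j).+1))
     (fun l j => hk h (j%:Z - l%:Z)) l.+1)`_l.

Lemma frob_coordP (A : comAlgType algC) (h : nat -> A) k j :
  hk h (Posz (k + j).+1) =
  \sum_(l < j.+1) frob_coord A h k l * hk h (j%:Z - l%:Z).
Proof.
apply: (triangular_solutionP A (fun j => hk h (Posz (k + j).+1))) => i.
by rewrite subrr.
Qed.

(** Defined directly as the entry of C Y P, which makes the link to [frob_coord] immediate. *)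
Definition frob_coord_FS (A : comAlgType algC) (h : nat -> A) (k i : nat) : A :=
  \sum_(k' < k.+1) \sum_(l < i.+1)
     (cpp k k' * (up_prod 0 i)`_l) *: frob_coord A h k' l.

(** X^a = C X P = C Y U P = C Y P U^a. Triangularity of U and P lets all sums run over common ranges
    before they are exchanged. *)
Lemma frob_coord_FSP (A : comAlgType algC) (h : nat -> A) k j :
  hka h (tau (- j%:Z) a_half) (Posz (k + j).+1) =
  \sum_(i < j.+1) frob_coord_FS A h k i
     * hka h (tau (- j%:Z) a_half) (j%:Z - i%:Z).
Proof.
(* Column j of U P = P U^a, obtained by applying H to [drop_up_prod]. *)
have shiftE l : \sum_(j' < j.+1) (up_prod 0 j)`_j' *: hk h (j'%:Z - l%:Z) =
    \sum_(i < j.+1) (up_prod 0 i)`_l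
      *: hka h (tau (- j%:Z) a_half) (j%:Z - i%:Z).
  transitivity (hlin A (fun i => hk h i) (drop_poly l (up_prod 0 j))).
    rewrite (hlin_widen A _ (j.+1 - l)); last first.
      by rewrite size_drop_poly leq_sub2r ?size_up_prod.
    pose F i := (up_prod 0 j)`_i *: hk h (i%:Z - l%:Z).
    rewrite -(big_mkord xpredT F).
    have F0 i : (i < l)%N -> F i = 0.
      move=> il; rewrite /F.
      have -> : i%:Z - l%:Z = Negz (l - i).-1 by lia.
      by rewrite scaler0.
    case: (leqP l j.+1) => lj; last first.
      rewrite big_nat big1 => [|i ij]; last by apply: F0; lia.
      have -> : (j.+1 - l = 0)%N by lia.
      by rewrite big_ord0.
    rewrite (big_cat_nat (leq0n l) lj) /= big_nat big1 ?add0r => [|i il]; last exact: F0.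
    rewrite -{1}[l]add0n big_addn big_mkord; apply: eq_bigr => i _.
    by rewrite coef_drop_poly /F -[RHS]/(_ *: hk h i); congr (_ *: hk h _); lia.
  rewrite drop_up_prod linear_sum; apply: eq_bigr => i _.
  by rewrite linearZ /= hka_neg_row // -ltnS.
have widenE k' j' : (j' < j.+1)%N -> hk h (Posz (k' + j').+1) =
    \sum_(l < j.+1) frob_coord A h k' l * hk h (j'%:Z - l%:Z).
  move=> j'j; rewrite frob_coordP.
  rewrite (big_ord_widen j.+1 (fun l => frob_coord A h k' l * hk h (j'%:Z - l%:Z))) //.
  rewrite big_mkcond; apply: eq_bigr => l _; case: ltnP => // lj'.
  have -> : j'%:Z - l%:Z = Negz (l - j').-1 by lia.
  by rewrite mulr0.
have FS_widen i : (i < j.+1)%N -> frob_coord_FS A h k i =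
    \sum_(k' < k.+1) \sum_(l < j.+1)
      (cpp k k' * (up_prod 0 i)`_l) *: frob_coord A h k' l.
  move=> ij; apply: eq_bigr => k' _.
  rewrite (big_ord_widen j.+1
    (fun l => (cpp k k' * (up_prod 0 i)`_l) *: frob_coord A h k' l)) //.
  rewrite big_mkcond; apply: eq_bigr => l _; case: ltnP => // il.
  by rewrite coef_up_prod (cpp_gt i) // !mulr0 scale0r.
rewrite hka_pos_row.
transitivity (\sum_(k' < k.+1) \sum_(l < j.+1) \sum_(i < j.+1)
   ((cpp k k' * (up_prod 0 i)`_l) *: frob_coord A h k' l)
     * hka h (tau (- j%:Z) a_half) (j%:Z - i%:Z)).
  apply: eq_bigr => k' _.
  transitivity (\sum_(l < j.+1) cpp k k' *: (frob_coord A h k' l *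
     \sum_(j' < j.+1) (up_prod 0 j)`_j' *: hk h (j'%:Z - l%:Z))).
    under [RHS]eq_bigr => l _ do rewrite mulr_sumr scaler_sumr.
    rewrite exchange_big; apply: eq_bigr => j' _.
    rewrite widenE // scaler_sumr; apply: eq_bigr => l _.
    by rewrite -scalerA -scalerAr.
  apply: eq_bigr => l _; rewrite shiftE mulr_sumr scaler_sumr.
  by apply: eq_bigr => i _; rewrite -scalerA -!scalerAl -scalerAr.
rewrite [RHS](eq_bigr (fun i : 'I_j.+1 => \sum_(k' < k.+1) \sum_(l < j.+1)
   ((cpp k k' * (up_prod 0 i)`_l) *: frob_coord A h k' l)
     * hka h (tau (- j%:Z) a_half) (j%:Z - i%:Z))).
  rewrite [RHS]exchange_big; apply: eq_bigr => k' _.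
  by rewrite exchange_big.
by move=> i _; rewrite FS_widen // mulr_suml; apply: eq_bigr => k' _; rewrite mulr_suml.
Qed.

(** * Giambelli's formula for s and FS, with the signs inside the entries *)

Lemma det_scale_cols_sign (R : comNzRingType) (d : nat) (q : seq nat)
    (M : 'M[R]_d) : size q = d ->
  (-1) ^+ sumn q * \det M = \det (\matrix_(i, j) ((-1) ^+ nth 0%N q j * M i j)).
Proof.
move=> qd.
have -> : \matrix_(i, j) ((-1) ^+ nth 0%N q j * M i j)
    = M *m diag_mx (\row_j (-1) ^+ nth 0%N q j).
  apply/matrixP => i j; rewrite !mxE (bigD1 j) //= !mxE eqxx mulr1n.
  rewrite big1 ?addr0 1?mulrC // => l lj.
  by rewrite !mxE (negbTE lj) mulr0n mulr0.
rewrite det_mulmx det_diag mulrC; congr (_ * _).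
rewrite sumnE (big_nth 0%N) qd big_mkord -prodrXr.
by apply: eq_bigr => i _; rewrite mxE.
Qed.

Lemma schur_giambelli (A : comAlgType algC) (h : nat -> A) d (p q : seq nat) :
  size p = d -> size q = d -> sdec q ->
  schur h (frob_part p q) =
  \det (\matrix_(i < d, j < d)
    ((-1) ^+ nth 0%N q j * frob_coord A h (nth 0%N p i) (nth 0%N q j))).
Proof.
move=> pd qd qs.
rewrite /schur (@giambelli A (fun k _ => hk h k) (frob_coord A h) d) //; last first.
  exact: frob_coordP.
rewrite det_scale_cols_sign //; congr (\det _).
by apply/matrixP => i j; rewrite !mxE.
Qed.

Lemma FS_giambelli (A : comAlgType algC) (h : nat -> A) d (p q : seq nat) :
  size p = d -> size q = d -> sdec q ->
  FS h (frob_part p q) =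
  \det (\matrix_(i < d, j < d)
    ((-1) ^+ nth 0%N q j * frob_coord_FS A h (nth 0%N p i) (nth 0%N q j))).
Proof.
move=> pd qd qs.
rewrite /FS /schur_a (@giambelli A
  (fun k j => hka h (tau (- j%:Z) a_half) k) (frob_coord_FS A h) d) //; last first.
  exact: frob_coord_FSP.
rewrite det_scale_cols_sign //; congr (\det _).
by apply/matrixP => i j; rewrite !mxE.
Qed.

(** The signs turn P into the transpose of C: (-1)^i times the coefficient (-1)^(i+l) c_{il} is
    (-1)^l c_{il}. The ranges grow to m and n because c_{pp'} = 0 for p' > p. *)
Lemma signed_frob_coord_FS (A : comAlgType algC) (h : nat -> A) m n k i :
  (k < m)%N -> (i < n)%N ->
  (-1) ^+ i * frob_coord_FS A h k i =
  \sum_(k' < m) \sum_(l < n)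
     (cpp k k' * cpp i l) *: ((-1) ^+ l * frob_coord A h k' l).
Proof.
move=> km iN; pose F k' l := (cpp k k' * cpp i l) *: ((-1) ^+ l * frob_coord A h k' l).
transitivity (\sum_(k' < k.+1) \sum_(l < i.+1) F k' l).
  rewrite mulr_sumr; apply: eq_bigr => k' _; rewrite mulr_sumr; apply: eq_bigr => l _.
  have signE (e : nat) (x : A) : (-1) ^+ e * x = (-1 : algC) ^+ e *: x.
    by rewrite -(signr_odd algC) scaler_sign -(signr_odd A) mulr_sign.
  rewrite coef_up_prod /F !signE !scalerA; congr (_ *: _).
  transitivity ((-1) ^+ i * (-1) ^+ i * (cpp k k' * cpp i l * (-1) ^+ l)).
    by rewrite exprD; ring.
  by rewrite -expr2 sqrr_sign mul1r.
rewrite (big_ord_widen m (fun k' => \sum_(l < i.+1) F k' l)) // big_mkcond.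
apply: eq_bigr => k' _; case: ltnP => [_|kk']; last first.
  by rewrite big1 // => l _; rewrite cpp_gt // mul0r scale0r.
rewrite (big_ord_widen n (F k')) // big_mkcond.
apply: eq_bigr => l _; case: ltnP => // il.
by rewrite /F (cpp_gt i) // mulr0 scale0r.
Qed.

(** * Vanishing terms and the double Cauchy-Binet expansion *)

Lemma head_sdec_ge (s : seq nat) i : sdec s -> (nth 0%N s i <= head 0%N s)%N.
Proof.
case: (ltnP i (size s)) => [|?]; last by rewrite nth_default.
case: s i => [|x s] [|i] //= si /sdec_cons/andP[/allP xs _].
by apply/ltnW/xs/mem_nth.
Qed.

Lemma nth_ffun_enum d n (f : {ffun 'I_d -> 'I_n}) (i : 'I_d) :
  nth 0%N [seq nat_of_ord (f i) | i <- enum 'I_d] i = f i.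
Proof. by rewrite (nth_map i 0%N) ?nth_ord_enum ?size_enum_ord. Qed.

(** Cauchy-Binet sums over all decreasing tuples; this cuts the sum down to the tuples with p'_i <=
    p_i for every i. *)
Lemma det_cpp_eq0 (p : seq nat) n (f : {ffun 'I_(size p) -> 'I_n}) :
  sdec p -> sdec [seq nat_of_ord (f i) | i <- enum 'I_(size p)] ->
  ~~ [forall i : 'I_(size p), (f i <= nth 0%N p i)%N] ->
  \det (\matrix_(i < size p, j < size p) cpp (nth 0%N p i) (f j)) = 0.
Proof.
move=> ps fs; rewrite negb_forall => /existsP[i0]; rewrite -ltnNge => i0f.
pose s := [seq nat_of_ord (f i) | i <- enum 'I_(size p)].
have weak (t : seq nat) : sdec t -> forall i j, (i <= j < size t)%N ->
    (nth 0%N t j <= nth 0%N t i)%N.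
  move=> ts i j /andP[]; rewrite leq_eqVlt => /predU1P[->//|ij] jt.
  by apply/ltnW/sdec_nth; rewrite ?ij.
have ss : size s = size p by rewrite size_map size_enum_ord.
rewrite -[RHS](det_decreasing_eq0 _ _ (nth 0%N p) (nth 0%N s) cpp i0).
- by congr (\det _); apply/matrixP => i j; rewrite !mxE nth_ffun_enum.
- exact: weak.
- by rewrite -ss; apply: weak.
- exact: cpp_gt.
- by rewrite nth_ffun_enum.
Qed.

Lemma det_alg_cpp (A : comAlgType algC) d n (p : seq nat) (f : 'I_d -> 'I_n) :
  \det (colsub f (\matrix_(i < d, k < n) (cpp (nth 0%N p i) k)%:A)) =
  (\det (\matrix_(i < d, j < d) cpp (nth 0%N p i) (f j)))%:A :> A.
Proof.
rewrite -[RHS]/(in_alg A _) -det_map_mx; congr (\det _).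
by apply/matrixP => i j; rewrite !mxE.
Qed.

Theorem theorem9 (A : comAlgType algC) (h : nat -> A) (p q : seq nat) :
  size p = size q -> sdec p -> sdec q ->
  FS h (frob_part p q) =
  \sum_(p' : {ffun 'I_(size p) -> 'I_(head 0%N p).+1} |
          sdec [seq nat_of_ord (p' i) | i <- enum 'I_(size p)] &&
          [forall i : 'I_(size p), (p' i <= nth 0%N p i)%N])
   \sum_(q' : {ffun 'I_(size p) -> 'I_(head 0%N q).+1} |
          sdec [seq nat_of_ord (q' i) | i <- enum 'I_(size p)] &&
          [forall i : 'I_(size p), (q' i <= nth 0%N q i)%N])
     ((\det (\matrix_(i < size p, j < size p) cpp (nth 0%N p i) (p' j))
       * \det (\matrix_(i < size p, j < size p) cpp (nth 0%N q i) (q' j)))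
      *: schur h (frob_part [seq nat_of_ord (p' i) | i <- enum 'I_(size p)]
                            [seq nat_of_ord (q' i) | i <- enum 'I_(size p)])).
Proof.
move=> pq ps qs; set d := size p.
have qd : size q = d by rewrite -pq.
rewrite (FS_giambelli A h d) //.
(* The head is the largest entry, so m and n make room for every index k <= p_i and l <= q_j. *)
pose m := (head 0%N p).+1; pose n := (head 0%N q).+1.
pose C r (s : seq nat) : 'M[A]_(d, r) := \matrix_(i, k) (cpp (nth 0%N s i) k)%:A.
pose G : 'M[A]_(m, n) := \matrix_(k, l) ((-1) ^+ l * frob_coord A h k l).
have -> : \matrix_(i < d, j < d)
    ((-1) ^+ nth 0%N q j * frob_coord_FS A h (nth 0%N p i) (nth 0%N q j))
    = C m p *m (G *m (C n q)^T).
  apply/matrixP => i j; rewrite !mxE (signed_frob_coord_FS A h m n);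
    rewrite ?ltnS ?head_sdec_ge //.
  apply: eq_bigr => k _; rewrite !mxE mulr_sumr; apply: eq_bigr => l _.
  by rewrite !mxE mulr_algr mulr_algl scalerA.
have sizeE r (f : {ffun 'I_d -> 'I_r}) :
    size [seq nat_of_ord (f i) | i <- enum 'I_d] = d.
  by rewrite size_map size_enum_ord.
(* The first expansion selects p' among the rows of [G], the second one below selects q' among its
   columns. *)
rewrite cauchy_binet (bigID (fun f : {ffun 'I_d -> 'I_m} =>
  [forall i : 'I_d, (f i <= nth 0%N p i)%N])) /= [X in _ + X]big1.
  2: by move=> f /andP[fs fp]; rewrite det_alg_cpp det_cpp_eq0 // scale0r mul0r.
rewrite addr0; apply: eq_bigr => f /andP[fs _].
have -> : rowsub f (G *m (C n q)^T) = rowsub f G *m (C n q)^T.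
  by apply/matrixP => i j; rewrite !mxE; apply: eq_bigr => l _; rewrite !mxE.
have trE g : rowsub g (C n q)^T = (colsub g (C n q))^T.
  by apply/matrixP => i j; rewrite !mxE.
rewrite cauchy_binet mulr_sumr (bigID (fun g : {ffun 'I_d -> 'I_n} =>
  [forall i : 'I_d, (g i <= nth 0%N q i)%N])) /= [X in _ + X]big1.
  2: {
  move=> g /andP[gs gq]; rewrite trE det_tr !det_alg_cpp.
  suff -> : \det (\matrix_(i < d, j < d) cpp (nth 0%N q i) (g j)) = 0.
    by rewrite scale0r !mulr0.
  (* [g] is indexed by [size p] but the lemma expects [size q]; generalizing over [g] lets the
     rewriting act on its type. *)
  move: g gs gq {trE}; rewrite /d pq => g gs gq; exact: det_cpp_eq0. }
rewrite addr0; apply: eq_bigr => g /andP[gs _].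
rewrite trE det_tr !det_alg_cpp (schur_giambelli A h d) ?sizeE //.
rewrite mulr_algr mulr_algl scalerA; congr (_ *: \det _).
by apply/matrixP => i j; rewrite !mxE !nth_ffun_enum.
Qed.
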